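(* For bipartite graphs $G$ with $\Delta(G)\le\Delta$, as $\Delta\to\infty$, $$\chi^\star_\ell(G) \le (1+o(1))\, \frac{\Delta}{\log \Delta} .$$
   Context: Graphs are finite and simple; $\Delta(G)$ is the maximum degree of $G$ and $\log$ is the natural logarithm. The $o(1)$ term depends only on $\Delta$: for every $\varepsilon>0$ there is $\Delta_0$ such that for all $\Delta\ge\Delta_0$ the inequality holds with $1+\varepsilon$ in place of $1+o(1)$ for every bipartite graph $G$ with $\Delta(G)\le\Delta$. A list-assignment $L$ of $G$ maps each vertex $v\in V(G)$ to a set $L(v)\subseteq\mathbb{N}$ of colours; it is a $k$-list-assignment if $|L(v)|=k$ for every $v$. A proper $L$-colouring is a map $c:V(G)\to\mathbb{N}$ with $c(v)\in L(v)$ for all $v$ and $c(u)\neq c(v)$ for every edge $uv$. A proper $L$-packing of $G$ of size $k$ is a collection of $k$ proper $L$-colourings $c_1,\dots,c_k$ that are mutually disjoint, i.e. $c_i(v)\neq c_j(v)$ for all $i\neq j$ and all $v\in V(G)$. The list packing number $\chi^\star_\ell(G)$ is the least $k$ such that $G$ admits a proper $L$-packing of size $k$ for every $k$-list-assignment $L$ of $G$. *)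

(* Defs.v *)
(* A finite simple graph is given by a symmetric irreflexive relation on a finType. *)
From mathcomp Require Import all_boot.
From mathcomp Require Import finmap.

Set Implicit Arguments.
Unset Strict Implicit.
Unset Printing Implicit Defensive.

Local Open Scope fset_scope.

Definition max_degree (V : finType) (e : rel V) : nat :=
  \max_(v : V) #|[set u | e v u]|.

Definition bipartite (V : finType) (e : rel V) : Prop :=
  exists A : {set V}, forall u v : V, e u v -> (u \in A) != (v \in A).

Definition list_assignment (V : finType) (k : nat) (L : V -> {fset nat}) : Prop :=
  forall v : V, #|` L v| = k.

Definition proper_list_colouring (V : finType) (e : rel V)
    (L : V -> {fset nat}) (c : V -> nat) : Prop :=
  (forall v : V, c v \in L v) /\ (forall u v : V, e u v -> c u <> c v).

Definition proper_list_packing (V : finType) (e : rel V)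
    (L : V -> {fset nat}) (k : nat) (c : 'I_k -> V -> nat) : Prop :=
  (forall i : 'I_k, proper_list_colouring e L (c i)) /\
  (forall i j : 'I_k, i <> j -> forall v : V, c i v <> c j v).

Definition list_packable (V : finType) (e : rel V) (k : nat) : Prop :=
  forall L : V -> {fset nat}, list_assignment k L ->
  exists c : 'I_k -> V -> nat, proper_list_packing e L c.

(* "k is the list packing number of e". The minimum is over positive integers:
   every graph is vacuously [list_packable] for k = 0 (the empty packing). *)
Definition is_list_packing_number (V : finType) (e : rel V) (k : nat) : Prop :=
  [/\ 0 < k, list_packable e k &
      forall m : nat, 0 < m -> list_packable e m -> k <= m].

(* Main.v *)
Require Import Defs.
From mathcomp Require Import all_boot all_order all_fingroup all_algebra.
From mathcomp Require Import finmap.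
From mathcomp Require Import boolp reals sequences exp.
From mathcomp Require Import zify ring lra.

Set Implicit Arguments.
Unset Strict Implicit.
Unset Printing Implicit Defensive.

Import Order.TTheory GRing.Theory Num.Theory.
Local Open Scope ring_scope.

(** Let [A] and its complement be the two sides of the graph, and let [k] be
    about [(1 + eps) * Delta / ln Delta].  A packing at a vertex [v] is a
    bijection between the [k] colourings and the [k] colours of [L v].  Choose
    such a bijection uniformly and independently at every vertex of [A].  A
    vertex [v] outside [A] can be completed exactly when some bijection sends
    each colour of [L v] to a colouring in which no neighbour of [v] already
    uses that colour.  Listing [L v] and [L a] so that their common colours
    sit at the same positions, this follows if there is a permutation that
    disagrees everywhere with each of at most [Delta] independent uniform
    permutations of [k] points.

    By Hall's theorem ([Hall], [permutation_or_rectangle]) no such permutation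
    exists only if the random permutations together cover a rectangle [S * T]
    with [#|S| + #|T| = k + 1].  A given cell stays uncovered with probability
    about [exp (- Delta / k)], that is [Delta ^ (- 1 / (1 + eps))].  Cells of
    one random permutation are not negatively correlated, but the loss is
    small for rectangles with few rows: given its values on the other rows of
    [S], a permutation is still uniform over at least [k - #|S|] values on the
    next row.  This gives [card_covers], where [k] is replaced by [k - #|S|];
    it is proved by averaging over transpositions that exchange the current
    row with a row outside [S].  Shrinking each rectangle to at most [k / r]
    rows, with [r] a large constant, costs only a constant factor in the
    exponent, so the union bound over all rectangles ([card_no_transversal])
    still beats every power of [Delta]: for a suitable [eps'] between [0] and
    [eps], the quantity [k * Delta ^ (- 1 / (1 + eps'))] is a positive power of
    [Delta] up to logarithms.

    The event that [v] cannot be completed depends only on the permutations at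
    the neighbours of [v], hence it interacts with at most [Delta ^ 2] others,
    and the local lemma ([Lovasz_local_lemma]) gives a choice that can be
    completed everywhere ([bipartite_list_packable]).  All probabilities are
    counts of elements of a finite product space. *)

(** * Finite sets *)

Lemma card_bigcup_le (J T : finType) (P : pred J) (F : J -> {set T}) :
  (#|\bigcup_(j | P j) F j| <= \sum_(j | P j) #|F j|)%N.
Proof.
apply: (big_ind2 (fun (A : {set T}) b => #|A| <= b)%N) => //.
  by rewrite cards0.
by move=> A a B b Aa Bb; apply: leq_trans (leq_card_setU _ _) (leq_add _ _).
Qed.

Lemma exists_subset_card (T : finType) (A : {set T}) (n : nat) :
  (n <= #|A|)%N -> exists2 B : {set T}, B \subset A & #|B| = n.
Proof.
rewrite -bin_gt0 -cards_draws => /card_gt0P [B].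
by rewrite inE => /andP [BA /eqP]; exists B.
Qed.

Lemma card_setIdE (T : finType) (A : {set T}) (P : pred T) :
  #|[set x in A | P x]| = (\sum_(x in A) P x)%N.
Proof.
by rewrite -sum1dep_card big_mkcondr; apply: eq_bigr => x _; case: (P x).
Qed.

Lemma bin_le_exp (n m : nat) : ('C(n, m) <= n ^ m)%N.
Proof.
have [mn|nm] := leqP m n; last by rewrite bin_small.
elim: m mn => [|m IH] mn; first by rewrite bin0.
have := mul_bin_left n m; rewrite expnS.
have := IH (ltnW mn); move: 'C(n, m) 'C(n, m.+1) (n ^ m)%N => a b c; nia.
Qed.

(** * Hall's theorem *)

(** If deleting [y] from the choices of [x] destroys Hall's condition, then
    every violating set contains [x]; the set below is a violator without
    [x]. *)
Lemma Hall_removal (X Y : finType) (F : X -> {set Y}) (x : X) (y : Y) :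
  (forall A : {set X}, #|A| <= #|\bigcup_(z in A) F z|)%N ->
  let G := fun z => if z == x then F x :\ y else F z in
  ~~ [forall A : {set X}, #|A| <= #|\bigcup_(z in A) G z|]%N ->
  exists A : {set X}, x \notin A /\
    (#|(F x :\ y) :|: \bigcup_(z in A) F z| <= #|A|)%N.
Proof.
move=> HF G /forallPn [A0]; rewrite -ltnNge => ltA0.
have GF (A : {set X}) : x \notin A ->
    \bigcup_(z in A) G z = \bigcup_(z in A) F z.
  move=> xA; apply: eq_bigr => z zA; rewrite /G.
  by case: eqP => // zx; rewrite -zx zA in xA.
have xA0 : x \in A0.
  by apply: contraLR ltA0 => /GF ->; rewrite -leqNgt HF.
exists (A0 :\ x); split; first by rewrite !inE eqxx.
move: ltA0; rewrite (big_setD1 x) //= {1}/G eqxx GF ?inE ?eqxx //.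
by rewrite (cardsD1 x A0) xA0 add1n ltnS.
Qed.

(** Rado's argument: while some [F x] has two elements, one of them can be
    deleted without losing Hall's condition.  Otherwise the two violators from
    [Hall_removal] contradict submodularity of the size of a union; when no
    deletion is left, every [F x] is a singleton. *)
Theorem Hall (X Y : finType) (F : X -> {set Y}) :
  (forall A : {set X}, #|A| <= #|\bigcup_(x in A) F x|)%N ->
  exists2 f : X -> Y, injective f & forall x, f x \in F x.
Proof.
have [n] := ubnP (\sum_x #|F x|)%N; elim: n F => // n IH F ltn HF.
case: (boolP [forall x, #|F x| <= 1]%N) => [/forallP F1 | /forallPn [x]].
  have Fx x : exists y, F x == [set y].
    suff /cards1P [y ->] : #|F x| == 1%N by exists y.
    by rewrite eqn_leq F1; have := HF [set x]; rewrite big_set1 cards1.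
  pose f x := xchoose (Fx x).
  have fE x : F x = [set f x] by apply/eqP; exact: (xchooseP (Fx x)).
  exists f => [x x' ff|x]; last by rewrite fE set11.
  apply/eqP; apply: contraT => nxx'.
  have := HF [set x; x']; rewrite cards2 nxx' big_setU1 ?inE //= big_set1.
  by rewrite !fE ff setUid cards1.
rewrite -ltnNge => /card_gt1P [y1 [y2 [y1F y2F ny]]].
have rem y : y \in F x ->
    [forall A : {set X}, #|A| <=
      #|\bigcup_(z in A) (if z == x then F x :\ y else F z)|]%N ->
    exists2 f : X -> Y, injective f & forall x, f x \in F x.
  move=> yF /forallP HG.
  have [|f injf fG] := IH (fun z => if z == x then F x :\ y else F z) _ HG.
    rewrite -ltnS; apply: leq_trans ltn; rewrite ltnS.
    rewrite [X in (_ < X)%N](bigD1 x) //= (bigD1 x) //= eqxx.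
    rewrite (cardsD1 y (F x)) yF add1n ltnS leq_add2l.
    by rewrite leq_eqVlt; apply/orP; left; apply/eqP/eq_bigr => z /negPf ->.
  exists f => // z; have := fG z; case: eqP => // ->.
  by rewrite inE => /andP[].
case: (boolP [forall A : {set X}, _]) (rem _ y1F) => [_ /(_ isT)//|].
move=> /(Hall_removal HF) [A1 [xA1 le1]] _.
case: (boolP [forall A : {set X}, _]) (rem _ y2F) => [_ /(_ isT)//|].
move=> /(Hall_removal HF) [A2 [xA2 le2]] _.
set P := _ :|: _ in le1; set Q := _ :|: _ in le2; exfalso.
(* Since y1 <> y2, the union still contains all of [F x]. *)
have leU : (#|A1 :|: A2|.+1 <= #|P :|: Q|)%N.
  have := HF (x |: (A1 :|: A2)); rewrite cardsU1 !inE negb_or xA1 xA2 add1n.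
  move/leq_trans; apply; apply: subset_leq_card; apply/bigcupsP => z.
  rewrite !inE => /or3P [/eqP ->|zA|zA]; apply/subsetP => y yF.
  - rewrite !inE yF !andbT; case: (eqVneq y y1) => [->|] //=.
    by rewrite ny !orbT.
  - by rewrite /P !inE; apply/orP; left; apply/orP; right; apply/bigcupP; exists z.
  - by rewrite /Q !inE; apply/orP; right; apply/orP; right; apply/bigcupP; exists z.
have leI : (#|A1 :&: A2| <= #|P :&: Q|)%N.
  apply: leq_trans (HF _) _; apply: subset_leq_card; apply/bigcupsP => z.
  rewrite inE => /andP [z1 z2]; apply/subsetP => y yF.
  rewrite !inE; apply/andP; split; apply/orP; right; apply/bigcupP; by exists z.
have := cardsUI P Q; have := cardsUI A1 A2; lia.
Qed.

(** The König form of Hall's theorem: a set violating Hall's condition in the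
    complement of [B], paired with the non-neighbours of that set, spans a
    rectangle contained in [B]. *)
Lemma permutation_or_rectangle (X : finType) (B : rel X) :
  (exists mu : {perm X}, forall x, ~~ B x (mu x)) \/
  (exists S T : {set X}, (#|S| + #|T|)%N = #|X|.+1 /\
     forall x i, x \in S -> i \in T -> B x i).
Proof.
pose F x := [set i | ~~ B x i].
case: (boolP [forall A : {set X}, #|A| <= #|\bigcup_(x in A) F x|]%N).
  move=> /forallP /Hall [f injf fF]; left; exists (perm injf) => x.
  by have := fF x; rewrite permE inE.
move=> /forallPn [S]; rewrite -ltnNge => ltS; right; exists S.
have leX : (#|S| <= #|X|)%N := max_card (mem S).
have : (#|X|.+1 - #|S| <= #|~: (\bigcup_(x in S) F x)|)%N.
  rewrite [X in (_ <= X)%N]cardsCs setCK; lia.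
case/exists_subset_card => T TF cT; exists T; split=> [|x i xS iT].
  rewrite cT; lia.
have := subsetP TF i iT; rewrite inE; apply: contraNT => nB.
by apply/bigcupP; exists x => //; rewrite inE.
Qed.

(** * The local lemma on a finite product space *)

Definition supported_on (I C : finType) (W : {set I}) (E : {set {ffun I -> C}}) :=
  forall w w' : {ffun I -> C}, {in W, w =1 w'} -> (w \in E) = (w' \in E).

Definition splice (I C : finType) (W : {set I}) (w w' : {ffun I -> C}) :
  {ffun I -> C} := [ffun i => if i \in W then w i else w' i].

(** Exchanging the [W1]-coordinates of a pair of points is an involution that
    carries [(E1 :&: E2) * Omega] onto [E1 * E2]. *)
Lemma independence (I C : finType) (W1 W2 : {set I})
    (E1 E2 : {set {ffun I -> C}}) :
  supported_on W1 E1 -> supported_on W2 E2 -> [disjoint W1 & W2] ->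
  (#|E1 :&: E2| * #|{ffun I -> C}| = #|E1| * #|E2|)%N.
Proof.
move=> sE1 sE2 dis.
pose swap (p : {ffun I -> C} * {ffun I -> C}) :=
  (splice W1 p.1 p.2, splice W1 p.2 p.1).
have swapK : involutive swap.
  move=> [w w']; rewrite /swap /=; congr pair;
    apply/ffunP => i; rewrite !ffunE /= ?ffunE;
    by case: (i \in W1).
rewrite -[#|{ffun I -> C}|]cardsT -!cardsX.
rewrite -(card_preimset (setX E1 E2) (inv_inj swapK)).
apply: eq_card => -[w w']; rewrite !inE andbT /=; congr andb.
  by apply: sE1 => i iW; rewrite /splice ffunE iW.
apply: sE2 => i iW; rewrite /splice ffunE; case: ifP => // iW1.
by rewrite (disjointFr dis iW1) in iW.
Qed.

Section LocalLemma.
Variables (R : realFieldType) (I C J : finType).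
Variables (vbl : J -> {set I}) (bad : J -> {set {ffun I -> C}}).
Variables (p : R) (D : nat).

Definition avoid (S : {set J}) := \bigcap_(j in S) ~: bad j.

Hypothesis bad_supp : forall j, supported_on (vbl j) (bad j).
Hypothesis bad_small : forall j, #|bad j|%:R <= p * #|{ffun I -> C}|%:R.
Hypothesis deg_le : forall j, (#|[set l | ~~ [disjoint vbl j & vbl l]]| <= D)%N.
Hypothesis D_gt0 : (0 < D)%N.
Hypothesis pD : 4 * p * D%:R <= 1.
Hypothesis C_inh : (0 < #|C|)%N.

Lemma card_omega_gt0 : (0 < #|{ffun I -> C}|)%N.
Proof. by rewrite card_ffun expn_gt0 C_inh. Qed.

Lemma avoid_supp (S : {set J}) (W : {set I}) :
  (forall j, j \in S -> [disjoint W & vbl j]) -> supported_on (~: W) (avoid S).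
Proof.
move=> dis w w' eqw.
have same j : j \in S -> (w \in bad j) = (w' \in bad j).
  move=> jS; apply: bad_supp => i iW; apply: eqw.
  by rewrite inE (disjointFl (dis j jS)).
by apply/bigcapP/bigcapP => H j jS; have := H j jS; rewrite !inE same.
Qed.

(** The inductive core of the local lemma.  Of the events in [S], those that
    share no coordinate with [bad j] are independent of it; adding back the at
    most [D] others at most halves the count, because by induction
    each of them removes at most a fraction [2 * p <= 1 / (2 * D)]. *)
Lemma bad_given_avoid (S : {set J}) (j : J) :
  #|bad j :&: avoid S|%:R <= 2 * p * #|avoid S|%:R.
Proof.
have O0 : 0 < #|{ffun I -> C}|%:R :> R by rewrite ltr0n card_omega_gt0.
have p0 : 0 <= p.
  by rewrite -(pmulr_lge0 _ O0) (le_trans _ (bad_small j)) ?ler0n.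
have D1 : 1 <= D%:R :> R by rewrite ler1n.
have [n] := ubnP #|S|; elim: n S j => // n IH S j ltS.
pose S1 := S :&: [set l | ~~ [disjoint vbl j & vbl l]]; pose S2 := S :\: S1.
have step : #|bad j :&: avoid S2|%:R <= p * #|avoid S2|%:R.
  rewrite -(ler_pM2r O0) -natrM (@independence _ _ (vbl j) (~: vbl j)) //.
  - by rewrite natrM mulrAC ler_wpM2r ?ler0n.
  - apply: avoid_supp => l; rewrite !inE => /andP [+ lS].
    by rewrite lS negbK.
  - by rewrite -subsets_disjoint.
have sub : avoid S \subset avoid S2.
  apply/subsetP => w /bigcapP H; apply/bigcapP => l.
  by rewrite inE => /andP[_]; apply: H.
suff half : #|avoid S2|%:R <= 2 * #|avoid S|%:R :> R.
  apply: le_trans (le_trans step _); last by nra.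
  by rewrite ler_nat subset_leq_card // setIS.
have [S10 | S1n0] := eqVneq S1 set0.
  have -> : S2 = S by rewrite /S2 S10 setD0.
  by rewrite ler_peMl ?ler0n // ler1n.
have ltS2 : (#|S2| < n)%N.
  rewrite -ltnS (leq_trans _ ltS) // ltnS cardsD (setIidPr (subsetIl _ _)).
  have : (0 < #|S1|)%N by rewrite card_gt0.
  by have := subset_leq_card (subsetIl S [set l | ~~ [disjoint vbl j & vbl l]]);
     rewrite -/S1; lia.
have cover : (#|avoid S2| <= #|avoid S| + \sum_(l in S1) #|bad l :&: avoid S2|)%N.
  apply: leq_trans (_ : #|avoid S :|: \bigcup_(l in S1) (bad l :&: avoid S2)| <= _)%N.
    apply: subset_leq_card; apply/subsetP => w w2.
    rewrite inE; case: (boolP (w \in avoid S)) => //= /bigcapP nw.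
    apply/bigcupP; case: (boolP [exists l in S1, w \in bad l]).
      by move=> /exists_inP [l l1 lb]; exists l => //; rewrite inE lb.
    move=> /exists_inPn nb; case: nw => l lS; rewrite inE.
    have [l1|l1] := boolP (l \in S1); first exact: nb.
    have /bigcapP/(_ l) := w2; rewrite [l \in S2]inE l1 lS inE.
    by apply.
  apply: leq_trans (leq_card_setU _ _) _; rewrite leq_add2l.
  exact: card_bigcup_le.
have sumle : \sum_(l in S1) #|bad l :&: avoid S2|%:R
    <= D%:R * (2 * p * #|avoid S2|%:R) :> R.
  apply: le_trans (_ : \sum_(l in S1) (2 * p * #|avoid S2|%:R) <= _).
    by apply: ler_sum => l _; apply: IH.
  rewrite sumr_const -[X in X <= _]mulr_natl ler_wpM2r ?ler_nat ?mulr_ge0 ?ler0n //.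
  by apply: leq_trans (deg_le j); apply: subset_leq_card; apply: subsetIr.
move: cover; rewrite -(ler_nat R) natrD natr_sum => cover.
have := le_trans cover (lerD (lexx _) sumle).
have := ler_wpM2r (ler0n R #|avoid S2|) pD; lra.
Qed.

(** Excluding the events one after the other, each removes at most the fraction
    [2 * p <= 1 / 2] of the points that are left. *)
Theorem Lovasz_local_lemma : exists w : {ffun I -> C}, forall j, w \notin bad j.
Proof.
suff pos (S : {set J}) : (0 < #|avoid S|)%N.
  have /card_gt0P [w /bigcapP aw] := pos setT.
  by exists w => j; have := aw j (in_setT j); rewrite inE.
have [n] := ubnP #|S|; elim: n S => // n IH S ltS.
have [->|[j jS]] := set_0Vmem S.
  by rewrite /avoid big_set0 cardsT card_omega_gt0.
have /IH pos : (#|S :\ j| < n)%N by rewrite (cardsD1 j S) jS in ltS.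
have := bad_given_avoid (S :\ j) j.
have -> : avoid S = avoid (S :\ j) :\: bad j.
  rewrite /avoid (big_setD1 j) //=; apply/setP => w; by rewrite !inE andbC.
have D1 : 1 <= D%:R :> R by rewrite ler1n.
rewrite lt0n cardsD [avoid _ :&: _]setIC; case: eqP => // E.
have {E} : (#|avoid (S :\ j)| <= #|bad j :&: avoid (S :\ j)|)%N.
  by rewrite -subn_eq0 E.
have p4 : 4 * p <= 1.
  have [p0|p0] := lerP p 0; first lra.
  have := ler_wpM2l (ltW p0) D1; have := pD; lra.
move: pos; rewrite -(ltr_nat R) -(ler_nat R) => pos leN le2.
have := ler_wpM2r (ltW pos) p4; lra.
Qed.

End LocalLemma.

(** * Rectangles covered by independent random permutations *)

Section RandomPermutations.
Variables (I X : finType).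
Local Notation Omega := {ffun I -> {perm X}}.

Definition hit (s : seq I) (x : X) (w : Omega) : {set X} :=
  [set i | has (fun a => w a x == i) s].

(** Exchanging the values of the permutation [w a] at [x] and [y].  This
    preserves the uniform measure, so averaging over [y] in a set [Y] resamples
    [w a x] among the values of [w a] on [Y]. *)
Definition reroute (a : I) (x y : X) (w : Omega) : Omega :=
  [ffun b => if b == a then (tperm x y * w b)%g else w b].

Lemma rerouteK a x y : involutive (reroute a x y).
Proof.
move=> w; apply/ffunP => b; rewrite !ffunE; case: eqP => // _.
by rewrite mulgA tperm2 mul1g.
Qed.

Lemma hit_cons (a : I) (s : seq I) (x : X) (w : Omega) :
  hit (a :: s) x w = w a x |: hit s x w.
Proof. by apply/setP => i; rewrite !inE /= eq_sym. Qed.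

Lemma hit_nil (x : X) (w : Omega) : hit [::] x w = set0.
Proof. by apply/setP => i; rewrite !inE. Qed.

Lemma hit_reroute_notin a s x y z w :
  a \notin s -> hit s z (reroute a x y w) = hit s z w.
Proof.
move=> sa; apply/setP => i; rewrite !inE; apply: eq_in_has => b bs.
by rewrite ffunE; case: (eqVneq b a) => // ba; rewrite ba (negPf sa) in bs.
Qed.

Lemma hit_reroute_other a s x y z w :
  z != x -> z != y -> hit s z (reroute a x y w) = hit s z w.
Proof.
move=> zx zy; apply/setP => i; rewrite !inE; apply: eq_has => b.
by rewrite ffunE; case: (eqVneq b a) => // _; rewrite permM tpermD // eq_sym.
Qed.

(** Averaging over the reroutings of [w a x] into [Y], which leave the event
    [E] unchanged: for at most one rerouting per element [i] of [T] does the new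
    value hit [i], and then only [T :\ i] has to be hit by the others. *)
Lemma card_cover_step (E : {set Omega}) (x : X) (Y : {set X}) a s (T : {set X}) :
  (forall y w, y \in Y -> (reroute a x y w \in E) = (w \in E)) ->
  a \notin s -> (#|T| <= #|Y|)%N ->
  (#|Y| * #|[set w in E | T \subset hit (a :: s) x w]| <=
   (#|Y| - #|T|) * #|[set w in E | T \subset hit s x w]| +
   \sum_(i in T) #|[set w in E | T :\ i \subset hit s x w]|)%N.
Proof.
move=> Einv sa leTY.
rewrite !card_setIdE; under [X in (_ <= _ + X)%N]eq_bigr do rewrite card_setIdE.
have -> : (#|Y| * \sum_(w in E) (T \subset hit (a :: s) x w) =
    \sum_(w in E) \sum_(y in Y) (T :\ w a y \subset hit s x w))%N.
  rewrite -sum_nat_const [RHS]exchange_big /=; apply: eq_bigr => y yY.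
  rewrite (reindex_inj (inv_inj (rerouteK a x y))) /=.
  apply: eq_big => [w|w _]; first by rewrite Einv.
  rewrite hit_cons hit_reroute_notin // ffunE eqxx permM tpermL.
  by rewrite subDset.
rewrite [X in (_ <= _ + X)%N]exchange_big /= big_distrr -big_split /=.
apply: leq_sum => w _; have [sub|nsub] := boolP (T \subset hit s x w).
  have all1 i : (T :\ i \subset hit s x w) = true.
    exact: subset_trans (subD1set _ _) sub.
  under eq_bigr do rewrite all1.
  under [X in (_ <= _ + X)%N]eq_bigr do rewrite all1.
  rewrite !sum1_card; lia.
(* Every rerouting that succeeds now must hit the one missing value of [T]. *)
rewrite muln0 add0n -!card_setIdE -(card_imset _ (@perm_inj _ (w a))).
apply: subset_leq_card; apply/subsetP => _ /imsetP [y + ->].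
rewrite !inE => /andP [_ sub]; rewrite sub andbT.
apply: contraR nsub => yT; apply: subset_trans sub.
by apply/subsetP => z zT; rewrite !inE zT andbT; apply: contraNneq yT => <-.
Qed.

Variable R : realFieldType.

(** The probability that at least one of [n] independent trials of success
    probability [1 / m] succeeds. *)
Definition hit_prob (m : R) (n : nat) : R := 1 - (1 - m^-1) ^+ n.

Lemma hit_prob_itv m n : 1 <= m -> 0 <= hit_prob m n <= 1.
Proof.
move=> m1; rewrite /hit_prob subr_ge0 gerBl.
have m01 : 0 <= 1 - m^-1 <= 1.
  rewrite subr_ge0 gerBl invr_ge0 (le_trans ler01 m1) andbT.
  by rewrite invf_le1 // (lt_le_trans ltr01).
by rewrite exprn_ge0 ?exprn_ile1 //; case/andP: m01.
Qed.

(** With [b := (1 - p) / m], this is the fact that the first two terms of the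
    binomial expansion of [(p + b) ^+ t] are a lower bound for it. *)
Lemma bernoulli_step (m p : R) (t : nat) : 1 <= m -> 0 <= p <= 1 ->
  (m - t%:R) * p ^+ t + t%:R * p ^+ t.-1 <= m * (p + (1 - p) / m) ^+ t.
Proof.
move=> m1 /andP [p0 p1]; case: t => [|t]; first by rewrite !expr0; lra.
have m0 : 0 < m by apply: lt_le_trans m1.
pose b := (1 - p) / m.
have b0 : 0 <= b by rewrite divr_ge0 ?subr_ge0 // ltW.
have mb : m * b = 1 - p by rewrite mulrCA divff ?mulr1 ?gt_eqF.
have two_terms : p ^+ t.+1 + t.+1%:R * p ^+ t * b <= (p + b) ^+ t.+1.
  elim: t => [|t IH]; first by rewrite expr1 expr0 !mul1r.
  rewrite [(p + b) ^+ _]exprSr.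
  apply: le_trans (ler_wpM2r (addr_ge0 p0 b0) IH).
  rewrite -!natr1 !exprSr.
  have := mulr_ge0 (exprn_ge0 t p0) (sqr_ge0 b).
  have := mulr_ge0 (ler0n R t) (mulr_ge0 (exprn_ge0 t p0) (sqr_ge0 b)); lra.
apply: le_trans (ler_wpM2l (ltW m0) two_terms) => /=.
rewrite [m * _]mulrDr -[t.+1%:R * p ^+ t * b]mulrA [p ^+ t * b]mulrC.
have -> : m * (t.+1%:R * (b * p ^+ t)) = t.+1%:R * ((m * b) * p ^+ t) by ring.
rewrite mb exprSr; lra.
Qed.

(** Given any event that is blind to reroutings of row [x] into [Y], the
    values in [T] are hit by row [x] as if they were negatively correlated,
    each with the probability for independent uniform draws from [#|Y|]
    values. *)
Lemma card_cover_row (E : {set Omega}) (x : X) (Y : {set X}) s (T : {set X}) :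
  (forall a y w, a \in s -> y \in Y -> (reroute a x y w \in E) = (w \in E)) ->
  uniq s -> (0 < #|Y|)%N -> (#|T| <= #|Y|)%N ->
  #|[set w in E | T \subset hit s x w]|%:R
    <= hit_prob #|Y|%:R (size s) ^+ #|T| * #|E|%:R.
Proof.
move=> + + Y0; elim: s T => [|a s IH] T Einv.
  move=> _ _; rewrite /hit_prob expr0 subrr expr0n cards_eq0.
  have [->|T0] := eqVneq T set0.
    by rewrite mul1r ler_nat subset_leq_card // setIdE subsetIl.
  rewrite mul0r lern0 cards_eq0; apply/eqP/setP => w.
  by rewrite !inE hit_nil subset0 (negPf T0) andbF.
move=> /= /andP [sa us] leTY.
have {}IH (T' : {set X}) : T' \subset T -> #|[set w in E | T' \subset hit s x w]|%:R
    <= hit_prob #|Y|%:R (size s) ^+ #|T'| * #|E|%:R.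
  move=> sub; apply: IH => //; last by apply: leq_trans leTY; apply: subset_leq_card.
  by move=> b y w bs yY; apply: Einv => //; rewrite inE bs orbT.
have m1 : 1 <= #|Y|%:R :> R by rewrite ler1n.
have m0 : 0 < #|Y|%:R :> R by rewrite ltr0n.
have := @card_cover_step E x Y a s T _ sa leTY.
have Einv' y w : y \in Y -> (reroute a x y w \in E) = (w \in E).
  by apply: Einv; rewrite inE eqxx.
move=> /(_ Einv'); rewrite -(ler_nat R) natrD !natrM natrB // natr_sum => step.
rewrite -(ler_pM2l m0); apply: le_trans step _; rewrite mulrA.
set p := hit_prob _ _ in IH.
have -> : hit_prob #|Y|%:R (size s).+1 = p + (1 - p) / #|Y|%:R.
  by rewrite /p /hit_prob exprSr; ring.
apply: le_trans (_ : ((#|Y|%:R - #|T|%:R) * p ^+ #|T| +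
    #|T|%:R * p ^+ #|T|.-1) * #|E|%:R <= _); last first.
  by rewrite ler_wpM2r ?ler0n // bernoulli_step // hit_prob_itv.
rewrite [leRHS]mulrDl lerD // -mulrA.
  by rewrite ler_wpM2l ?subr_ge0 ?ler_nat // IH.
rewrite mulr_natl -sumr_const; apply: ler_sum => i iT.
have -> : #|T|.-1 = #|T :\ i| by rewrite (cardsD1 i T) iT.
by apply: IH; apply: subD1set.
Qed.

Definition covers (s : seq I) (S T : {set X}) (w : Omega) : bool :=
  [forall x in S, T \subset hit s x w].

(** Rows are treated one at a time with [Y := ~: S]: rerouting into [Y] does
    not disturb the other rows of [S], so each row of the rectangle costs a
    factor [hit_prob ^+ #|T|] whatever happens on the others.  The assumption
    [#|S| + #|T| <= #|X|] keeps [#|T| <= #|Y|], which makes the weights in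
    [card_cover_step] nonnegative. *)
Lemma card_covers (s : seq I) (S T : {set X}) :
  uniq s -> (0 < #|T|)%N -> (#|S| + #|T| <= #|X|)%N ->
  #|[set w | covers s S T w]|%:R <=
    hit_prob (#|X| - #|S|)%:R (size s) ^+ (#|S| * #|T|) * #|Omega|%:R.
Proof.
move=> us T0 leX.
have cY : #|~: S| = (#|X| - #|S|)%N by rewrite cardsCs setCK.
have leTY : (#|T| <= #|~: S|)%N by rewrite cY; lia.
have m1 : 1 <= #|~: S|%:R :> R by rewrite ler1n; lia.
rewrite -cY; set p := hit_prob _ _.
suff rows (S' : {set X}) : S' \subset S ->
    #|[set w | covers s S' T w]|%:R <= p ^+ (#|S'| * #|T|) * #|Omega|%:R.
  exact: rows.
have [n] := ubnP #|S'|; elim: n S' => // n IH S' ltS' sub.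
have [->|[x xS']] := set_0Vmem S'.
  by rewrite cards0 mul0n expr0 mul1r ler_nat max_card.
have -> : [set w | covers s S' T w] =
    [set w in [set w | covers s (S' :\ x) T w] | T \subset hit s x w].
  apply/setP => w; rewrite !inE; apply/forall_inP/andP => [H|[/forall_inP H Hx] z zS'].
    by split; [apply/forall_inP => z /setD1P [_]; apply: H | apply: H].
  by have [->//|zx] := eqVneq z x; apply: H; rewrite !inE zx.
apply: le_trans (card_cover_row (Y := ~: S) _ us _ leTY) _; last first.
- have cS' : #|S'| = #|S' :\ x|.+1 by rewrite (cardsD1 x S') xS'.
  rewrite cS' mulSn exprD -mulrA ler_wpM2l //.
    by rewrite exprn_ge0 //; case/andP: (hit_prob_itv (size s) m1).
  apply: IH; first by rewrite -ltnS -cS'.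
  exact: subset_trans (subD1set _ _) sub.
- lia.
move=> a y w _; rewrite inE => yS; rewrite !inE.
apply: eq_forallb_in => z; rewrite !inE => /andP [zx zS'].
rewrite hit_reroute_other //; apply: contraNneq yS => <-.
exact: (subsetP sub).
Qed.
End RandomPermutations.

(** * Permutations avoiding all the random permutations *)

(** The price of one row in the union bound.  A rectangle is shrunk to at most
    [M] rows and exactly [uphalf k] columns, which keeps at least one row in
    [r]; each cell that is kept is uncovered with probability at least
    [(1 - 1 / (k - M)) ^+ Delta]. *)
Definition rectangle_decay (R : realType) (k Delta M r : nat) : R :=
  expR (- ((1 - (k - M)%:R^-1) ^+ Delta * (uphalf k)%:R / r%:R)).

Section Transversals.
Variables (R : realType) (I X : finType) (s : seq I) (Delta M r : nat).
Local Notation Omega := {ffun I -> {perm X}}.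
Local Notation k := #|X|.

Definition no_transversal : {set Omega} :=
  [set w | ~~ [exists mu : {perm X}, forall x, mu x \notin hit s x w]].

Local Notation y := (rectangle_decay R k Delta M r).

Hypothesis us : uniq s.
Hypothesis s_le : (size s <= Delta)%N.
Hypothesis r_gt0 : (0 < r)%N.
Hypothesis M_le : (M + uphalf k <= k)%N.
Hypothesis M_ge : (k < 2 * (r * M))%N.

(** Passing to [minn #|S| M] rows loses at most a factor [r], as [#|S|] is at
    most half of [k + 1]; it keeps the effective range of each permutation at
    [k - M] values or more. *)
Lemma card_covers_le (S T : {set X}) :
  (#|S| + #|T|)%N = k.+1 -> (#|S| <= #|T|)%N ->
  #|[set w : Omega | covers s S T w]|%:R <= y ^+ #|S| * #|Omega|%:R.
Proof.
move=> ST leST.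
have k0 : (0 < k)%N by have : (#|T| <= k)%N := max_card _; lia.
have h0 : (0 < uphalf k)%N by rewrite uphalf_gt0.
have [S' subS cS] : exists2 S' : {set X}, S' \subset S & #|S'| = minn #|S| M.
  by apply: exists_subset_card; rewrite geq_minl.
have [T' subT cT] : exists2 T' : {set X}, T' \subset T & #|T'| = uphalf k.
  by apply: exists_subset_card; rewrite uphalf_half; lia.
apply: le_trans (_ : #|[set w : Omega | covers s S' T' w]|%:R <= _).
  rewrite ler_nat subset_leq_card //; apply/subsetP => w; rewrite !inE.
  move=> /forall_inP H; apply/forall_inP => x xS'.
  by apply: subset_trans subT _; apply: H; apply: (subsetP subS).
have leX : (#|S'| + #|T'| <= k)%N by rewrite cS cT; lia.
have := @card_covers _ _ R s S' T' us _ leX; rewrite cT => /(_ h0) /le_trans.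
apply; rewrite ler_wpM2r ?ler0n //.
have m1 : 1 <= (k - #|S'|)%:R :> R by rewrite ler1n cS; lia.
have M1 : 1 <= (k - M)%:R :> R by rewrite ler1n; lia.
have mM : (k - M)%:R <= (k - #|S'|)%:R :> R by rewrite ler_nat cS; lia.
have M0 : 0 < (k - M)%:R :> R by apply: lt_le_trans M1.
pose q : R := (1 - (k - M)%:R^-1) ^+ Delta.
have u0 : 0 <= 1 - (k - M)%:R^-1 :> R by rewrite subr_ge0 invf_le1.
have q0 : 0 <= q by rewrite exprn_ge0.
have hp : hit_prob (k - #|S'|)%:R (size s) <= expR (- q).
  apply: le_trans (expR_ge1Dx _); rewrite lerD2l lerN2 /q.
  apply: le_trans (_ : (1 - (k - M)%:R^-1) ^+ size s <= _).
    rewrite ler_wiXn2l // gerBl invr_ge0; exact: ltW.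
  apply: lerXn2r; rewrite ?nnegrE //.
    by rewrite subr_ge0 invf_le1 // (lt_le_trans ltr01 m1).
  by rewrite lerD2l lerN2 lef_pV2 // posrE (lt_le_trans ltr01 m1).
have hp0 : 0 <= hit_prob (k - #|S'|)%:R (size s) :> R.
  by case/andP: (hit_prob_itv (size s) m1).
apply: le_trans (_ : expR (- q) ^+ (#|S'| * uphalf k) <= _).
  by apply: lerXn2r; rewrite ?nnegrE ?expR_ge0.
rewrite /rectangle_decay -!expRM_natl ler_expR -/q !mulrN lerN2 natrM.
have r0 : 0 < r%:R :> R by rewrite ltr0n.
have sr : #|S|%:R <= r%:R * #|S'|%:R :> R.
  rewrite -natrM ler_nat cS /minn; case: ifP => _; first by rewrite leq_pmull.
  move: M_ge; clear -ST leST; move: (r * M)%N => c; lia.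
have leS : #|S|%:R / r%:R <= #|S'|%:R :> R by rewrite ler_pdivrMr // mulrC.
have -> : #|S|%:R * (q * (uphalf k)%:R / r%:R) =
    #|S|%:R / r%:R * (q * (uphalf k)%:R) by ring.
rewrite -[leRHS]mulrA [(uphalf k)%:R * q]mulrC ler_wpM2r // mulr_ge0 ?ler0n //.
Qed.

(** It is enough to bound rectangles with at least as many columns as rows:
    inverting all the permutations exchanges rows and columns. *)
Definition wide_rectangles : {set {set X} * {set X}} :=
  [set P : {set X} * {set X} |
    (#|P.1| + #|P.2| == k.+1)%N && (#|P.1| <= #|P.2|)%N].

Hypothesis y_small : k%:R ^+ 2 * y <= 1.

(** There are at most [k ^ (2 * j)] of these rectangles with [j] rows, so each
    [j] contributes at most [(k ^ 2 * y) ^ j], hence at most [k ^ 2 * y]; the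
    last factor [k] counts the values of [j]. *)
Lemma sum_wide_rectangles :
  \sum_(P in wide_rectangles) y ^+ #|P.1| <= k%:R ^+ 3 * y.
Proof.
have y0 : 0 <= y by apply: expR_ge0.
have lt_k (P : {set X} * {set X}) : (#|P.1| < k.+1)%N by rewrite ltnS max_card.
pose j0 (P : {set X} * {set X}) : 'I_k.+1 := Ordinal (lt_k P).
rewrite (partition_big j0 (fun j : 'I_k.+1 => j != ord0)) /=; last first.
  move=> P; rewrite inE => /andP [/eqP PE _]; rewrite -val_eqE /=.
  by have : (#|P.2| <= k)%N := max_card _; lia.
apply: le_trans (_ : \sum_(j < k.+1 | j != ord0) k%:R ^+ 2 * y <= _); last first.
  rewrite sumr_const -[leLHS]mulr_natl cardC1 card_ord /=.
  by rewrite [leLHS]mulrA -exprS.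
apply: ler_sum => j; rewrite -val_eqE /= => jn0.
rewrite (eq_bigr (fun _ => y ^+ j)); last by move=> P /andP [_ /eqP <-].
rewrite sumr_const -[leLHS]mulr_natl.
apply: le_trans (_ : (k%:R ^+ 2) ^+ j * y ^+ j <= _); last first.
  rewrite -exprMn -[leRHS]expr1; apply: ler_wiXn2l => //.
    by rewrite mulr_ge0 ?exprn_ge0 ?ler0n.
  by rewrite lt0n.
rewrite ler_wpM2r ?exprn_ge0 // -exprM -natrX ler_nat.
apply: leq_trans (_ : #|setX [set S : {set X} | #|S| == j]
    [set T : {set X} | #|T| == k.+1 - j]%N| <= _)%N.
  apply: subset_leq_card; apply/subsetP => -[S T]; rewrite !inE /=.
  rewrite [in X in X -> _]unfold_in /= inE -val_eqE /=.
  by move=> /andP [/andP [/eqP ST _] /eqP <-]; rewrite eqxx /=; apply/eqP; lia.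
rewrite cardsX !card_draws mul2n -addnn expnD leq_mul ?bin_le_exp //.
have jk := ltn_ord j.
rewrite -bin_sub ?leq_subr //; last by lia.
have -> : (k - (k.+1 - j) = j.-1)%N.
  by case: (nat_of_ord j) jn0 jk => // i _ ik; rewrite subSS subKn // ltnW.
apply: leq_trans (bin_le_exp _ _) _; rewrite leq_pexp2l ?leq_pred //.
by case: (nat_of_ord j) jn0 jk => // i _; rewrite ltnS; apply: leq_ltn_trans.
Qed.

Lemma card_no_transversal :
  #|no_transversal|%:R <= 2 * k%:R ^+ 3 * y * #|Omega|%:R.
Proof.
pose W := \bigcup_(P in wide_rectangles) [set w : Omega | covers s P.1 P.2 w].
pose inv (w : Omega) : Omega := [ffun a => (w a)^-1%g].
have invK : involutive inv.
  by move=> w; apply/ffunP => a; rewrite !ffunE invgK.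
have cardW : #|W|%:R <= k%:R ^+ 3 * y * #|Omega|%:R.
  apply: le_trans (ler_wpM2r (ler0n _ _) sum_wide_rectangles).
  rewrite mulr_suml.
  apply: le_trans (_ : \sum_(P in wide_rectangles)
     #|[set w : Omega | covers s P.1 P.2 w]|%:R <= _).
    rewrite -natr_sum ler_nat.
    exact: card_bigcup_le.
  apply: ler_sum => -[S T]; rewrite inE => /andP [/eqP ST leST].
  exact: card_covers_le.
have sub : no_transversal \subset W :|: inv @^-1: W.
  apply/subsetP => w; rewrite !inE => /existsPn nmu.
  have [[mu nB]|[S [T [ST cov]]]] :=
    permutation_or_rectangle (fun x i => i \in hit s x w).
    by have /forallPn [x] := nmu mu; rewrite (nB x).
  have [leST|ltTS] := leqP #|S| #|T|.
    apply/orP; left; apply/bigcupP; exists (S, T); rewrite !inE ?ST ?eqxx //.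
    by apply/forall_inP => x xS; apply/subsetP => i iT; apply: cov.
  apply/orP; right; apply/bigcupP; exists (T, S).
    by rewrite !inE addnC ST eqxx ltnW.
  rewrite inE; apply/forall_inP => i iT; apply/subsetP => x xS.
  have := cov x i xS iT; rewrite !inE => /hasP [a sa /eqP <-].
  by apply/hasP; exists a; rewrite ?ffunE ?permK.
have := leq_trans (subset_leq_card sub) (leq_card_setU _ _).
rewrite (card_preimset _ (inv_inj invK)) -(ler_nat R) natrD; lra.
Qed.

End Transversals.

(** * List packings of bipartite graphs *)

Lemma extend_to_perm (T : finType) (D : {set T}) (f : T -> T) :
  {in D &, injective f} -> exists g : {perm T}, {in D, g =1 f}.
Proof.
have [n] := ubnP #|D|; elim: n D => // n IH D ltD injf.
have [->|[x xD]] := set_0Vmem D; first by exists 1%g => z; rewrite inE.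
have ltDx : (#|D :\ x| < n)%N by rewrite (cardsD1 x D) xD in ltD.
have [|g gf] := IH _ ltDx.
  by move=> u v /setD1P [_ uD] /setD1P [_ vD]; apply: injf.
exists (g * tperm (g x) (f x))%g => z zD; rewrite permM.
have [->|zx] := eqVneq z x; first by rewrite tpermL.
have gz : g z = f z by apply: gf; rewrite !inE zx.
rewrite tpermD // gz; first by rewrite -gz (inj_eq perm_inj) eq_sym.
by apply: contra zx => /eqP /injf -> .
Qed.

(** A relabelling of positions under which two colour lists agree on their
    common colours.  It lets one treat all neighbours of a vertex as if they
    had the same list as the vertex, where their permutations can only block
    more. *)
Lemma align_lists (k : nat) (s t : seq nat) :
  size s = k -> size t = k -> uniq s -> uniq t ->
  exists g : {perm 'I_k}, forall i j : 'I_k, nth 0%N s i = nth 0%N t j -> g i = j.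
Proof.
move=> ss st us ut.
have injs (i j : 'I_k) : nth 0%N s i = nth 0%N s j -> i = j.
  by move/eqP; rewrite nth_uniq ?ss // => /eqP /val_inj.
have injt (i j : 'I_k) : nth 0%N t i = nth 0%N t j -> i = j.
  by move/eqP; rewrite nth_uniq ?st // => /eqP /val_inj.
pose f (i : 'I_k) := odflt i [pick j : 'I_k | nth 0%N s i == nth 0%N t j].
have fE (i j : 'I_k) : nth 0%N s i = nth 0%N t j -> f i = j.
  move=> ij; rewrite /f; case: pickP => [j' /eqP ij'|/(_ j)]; last by rewrite ij eqxx.
  by apply: injt; rewrite -ij.
pose D := [set i : 'I_k | [exists j : 'I_k, nth 0%N s i == nth 0%N t j]].
have [i i'|g gf] := @extend_to_perm _ D f.
  rewrite !inE => /existsP [j /eqP ij] /existsP [j' /eqP ij'].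
  by rewrite (fE _ _ ij) (fE _ _ ij') => jj; apply: injs; rewrite ij ij' jj.
exists g => i j ij; rewrite gf ?(fE _ _ ij) // inE.
by apply/existsP; exists j; rewrite ij.
Qed.

Lemma card_common_neighbour (V : finType) (e : rel V) (Delta : nat) (v : V) :
  symmetric e -> (max_degree e <= Delta)%N ->
  (#|[set u | ~~ [disjoint [set a | e v a] & [set a | e u a]]]| <= Delta * Delta)%N.
Proof.
move=> sym degD.
have deg u : (#|[set a | e u a]| <= Delta)%N.
  exact: leq_trans (leq_bigmax u) degD.
apply: leq_trans (_ : #|\bigcup_(a in [set a | e v a]) [set u | e a u]| <= _)%N.
  apply: subset_leq_card; apply/subsetP => u; rewrite inE => /pred0Pn [a].
  rewrite /= !inE => /andP [va ua]; apply/bigcupP; exists a; rewrite inE //.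
  by rewrite sym.
apply: leq_trans (card_bigcup_le _ _) _.
apply: leq_trans (_ : \sum_(a in [set a | e v a]) Delta <= _)%N.
  by apply: leq_sum => a _; apply: deg.
by rewrite sum_nat_const leq_mul2r deg orbT.
Qed.

Section Packing.
Variables (R : realType) (k Delta M r : nat).
Local Notation y := (rectangle_decay R k Delta M r).

(** The random permutation [w a] lists the colours of [a] by colouring.  The
    composite [rho v w a] sends a position in the list of [v] to the colouring
    in which [a] uses the corresponding colour, so a permutation avoiding all
    of these over the neighbours [a] of [v] extends every colouring to [v]. *)
Lemma bipartite_list_packable (V : finType) (e : rel V) :
  (0 < k)%N -> (0 < Delta)%N -> (0 < r)%N -> (M + uphalf k <= k)%N ->
  (k < 2 * (r * M))%N -> k%:R ^+ 2 * y <= 1 ->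
  8 * k%:R ^+ 3 * y * Delta%:R ^+ 2 <= 1 ->
  symmetric e -> bipartite e -> (max_degree e <= Delta)%N ->
  list_packable e k.
Proof.
move=> k0 D0 r0 M_le M_ge y_small yD sym [A HA] degD L Lk.
pose N v := [set a | e v a].
have degN v : (#|N v| <= Delta)%N by apply: leq_trans (leq_bigmax v) degD.
pose col v (i : 'I_k) := nth 0%N (enum_fset (L v)) i.
have szL v : size (enum_fset (L v)) = k by rewrite -[RHS](Lk v) cardfE ?cardE.
have col_in v i : col v i \in L v by rewrite mem_nth ?szL.
have col_inj v : injective (col v).
  by move=> i j /eqP; rewrite nth_uniq ?szL ?fset_uniq // => /eqP /val_inj.
have exg v a : exists g : {perm 'I_k}, forall i j, col v i = col a j -> g i = j.
  by apply: align_lists; rewrite ?fset_uniq.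
have {exg}exg v : exists g : V -> {perm 'I_k}, forall a i j,
    col v i = col a j -> g a i = j.
  exact: fin_all_exists (exg v).
have {exg}[g gE] := fin_all_exists exg.
pose rho v (w : {ffun V -> {perm 'I_k}}) : {ffun V -> {perm 'I_k}} :=
  [ffun a => (g v a * (w a)^-1)%g].
have rho_inj v : injective (rho v).
  move=> w w' /ffunP ww; apply/ffunP => a; have := ww a; rewrite !ffunE.
  by move=> /mulgI /invg_inj.
pose bad v := if v \in A then set0 else
  rho v @^-1: no_transversal 'I_k (enum (N v)).
have [w wP] : exists w : {ffun V -> {perm 'I_k}}, forall v, w \notin bad v.
  apply: (@Lovasz_local_lemma R V _ V N bad (2 * k%:R ^+ 3 * y) (Delta * Delta)).
  - move=> v w w' ww; rewrite /bad; case: ifP => // _; first by rewrite !inE.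
    rewrite !inE; congr negb; apply: eq_existsb => mu; apply: eq_forallb => x.
    congr negb; rewrite !inE; apply: eq_in_has => a.
    by rewrite mem_enum !ffunE => /ww ->.
  - have y0 : 0 <= y by apply: expR_ge0.
    move=> v; rewrite /bad; case: ifP => _.
      by rewrite cards0 !mulr_ge0 ?exprn_ge0 ?ler0n.
    rewrite card_preimset //.
    have := @card_no_transversal R V 'I_k (enum (N v)) Delta M r.
    rewrite card_ord => /(_ (enum_uniq _)); apply => //.
    by rewrite -cardE.
  - by move=> v; apply: card_common_neighbour.
  - by rewrite muln_gt0 D0.
  - rewrite natrM; apply: le_trans yD; rewrite le_eqVlt; apply/orP; left.
    by apply/eqP; ring.
  - by apply/card_gt0P; exists 1%g.
have exmu v : exists mu : {perm 'I_k}, v \notin A -> forall a i, e v a ->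
    col v (mu i) <> col a (w a i).
  case: (boolP (v \in A)) => vA; first by exists 1%g.
  have := wP v; rewrite /bad (negPf vA) !inE negbK => /existsP [mu /forallP muP].
  exists (mu^-1)%g => _ a i va /gE gi.
  have := muP ((mu^-1)%g i); rewrite permKV inE => /hasPn /(_ a).
  by rewrite mem_enum inE va ffunE permM gi permK eqxx => /(_ isT).
have {exmu}[mu muP] := fin_all_exists exmu.
exists (fun i v => if v \in A then col v (w v i) else col v (mu v i)).
split=> [i|i j ij v].
  split=> [v|u v euv]; first by case: ifP => _; apply: col_in.
  have := HA u v euv; case: ifP => uA; case: ifP => vA // _.
    by move=> /esym; apply: muP; rewrite ?vA // sym.
  by apply: muP; rewrite ?uA.
by case: ifP => _ /col_inj /perm_inj.
Qed.

End Packing.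

(** * Asymptotics *)

Section Asymptotics.
Variable R : realType.

Lemma double_uphalf_ge (n : nat) : (n <= 2 * uphalf n)%N.
Proof. rewrite uphalf_half; lia. Qed.

Lemma quotient_window (k r : nat) : (4 <= r)%N -> (2 * r <= k)%N ->
  (k %/ r + uphalf k <= k)%N /\ (k < 2 * (r * (k %/ r)))%N.
Proof.
move=> r4 rk; have kM : (k < (k %/ r).+1 * r)%N.
  by rewrite -ltn_divLR ?ltnSn // (leq_trans _ r4).
have Mk : (k %/ r * 4 <= k)%N.
  by apply: leq_trans (leq_divM k r); rewrite leq_mul2l r4 orbT.
rewrite uphalf_half mulSn in kM *; split; first by lia.
by move: kM; rewrite mulnC; move: (r * (k %/ r))%N => c; lia.
Qed.

Lemma expRN_inv_le (m : R) : 1 < m -> expR (- (m - 1)^-1) <= 1 - m^-1.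
Proof.
move=> m1; have m0 : 0 < m - 1 by rewrite subr_gt0.
rewrite expRN -[leRHS]invrK lef_pV2 ?posrE ?expR_gt0 //; last first.
  by rewrite invr_gt0 subr_gt0 invf_lt1 // (lt_trans ltr01).
apply: le_trans (expR_ge1Dx _); rewrite le_eqVlt; apply/orP; left; apply/eqP.
by field; rewrite !gt_eqF //; lra.
Qed.

(** Write [Delta = exp x].  As [k - M] exceeds [(1 + u) * Delta / x], a cell is
    uncovered with probability at least [exp (- x / (1 + u))]; over [k / 2]
    columns the exponent is at least [exp (u * x / 2) / (2 * x)], which
    outgrows every linear function of [x].  The bound [z ^ 3 / 6 <= exp z]
    with [z = u * x / 2] makes this explicit: it bounds the exponent below by
    [x ^ 2 * u ^ 3 / (96 * r)], and [576 = 6 * 96].  The target [6 * x] leaves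
    a factor [Delta] against the [k ^ 3 * Delta ^ 2 <= Delta ^ 5] of the local
    lemma. *)
Lemma rectangle_decay_le (u x : R) (k Delta M r : nat) :
  0 < u -> u <= 1 -> 0 < x -> (0 < r)%N -> (M <= k)%N ->
  Delta%:R = expR x ->
  (1 + u) * (Delta%:R / x) + 1 <= (k - M)%:R -> Delta%:R / x <= k%:R ->
  576 * r%:R / u ^+ 3 <= x ->
  rectangle_decay R k Delta M r <= expR (- (6 * x)).
Proof.
move=> u0 u1 x0 r0 Mk Dx mge kge xge.
have D0 : 0 < Delta%:R :> R by rewrite Dx expR_gt0.
have r0' : 0 < r%:R :> R by rewrite ltr0n.
rewrite /rectangle_decay ler_expR lerN2.
set m : R := (k - M)%:R in mge *.
have Dx0 : 0 < Delta%:R / x by rewrite divr_gt0.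
have m1 : 1 < m by apply: lt_le_trans mge; rewrite ltrDr mulr_gt0 //; lra.
have Q1 : expR (- (x / (1 + u))) <= (1 - m^-1) ^+ Delta.
  apply: le_trans (_ : expR (- (m - 1)^-1) ^+ Delta <= _); last first.
    apply: lerXn2r; rewrite ?nnegrE ?expR_ge0 ?expRN_inv_le //.
    by rewrite subr_ge0 invf_le1 ?ltW // (lt_trans ltr01).
  rewrite -expRM_natl ler_expR mulrN lerN2.
  rewrite ler_pdivrMr ?subr_gt0 // mulrAC ler_pdivlMr; last lra.
  have : (1 + u) * (Delta%:R / x) * x <= (m - 1) * x.
    by apply: ler_wpM2r; [apply: ltW | lra].
  have -> : (1 + u) * (Delta%:R / x) * x = Delta%:R * (1 + u).
    by field; rewrite gt_eqF.
  by rewrite [x * _]mulrC.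
have h1 : Delta%:R / x / 2 <= (uphalf k)%:R.
  have : k%:R <= (2 * uphalf k)%:R :> R by rewrite ler_nat double_uphalf_ge.
  by rewrite natrM; lra.
have QH : expR (u * x / 2) / (2 * x) <= (1 - m^-1) ^+ Delta * (uphalf k)%:R.
  apply: le_trans (ler_pM (expR_ge0 _) _ Q1 h1); last by rewrite divr_ge0 ?ltW.
  rewrite Dx.
  have -> : expR (- (x / (1 + u))) * (expR x / x / 2) =
     expR (- (x / (1 + u)) + x) / (2 * x) by rewrite expRD; field; rewrite gt_eqF.
  rewrite ler_pM2r ?invr_gt0 ?mulr_gt0 // ler_expR.
  have -> : - (x / (1 + u)) + x = u * x / (1 + u) by field; rewrite gt_eqF //; lra.
  apply: ler_wpM2l; first by apply: mulr_ge0; apply: ltW.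
  by rewrite lef_pV2 ?posrE; lra.
have cubic : (u * x / 2) ^+ 3 / 6 <= expR (u * x / 2).
  have ux : 0 <= u * x / 2 by rewrite divr_ge0 // mulr_ge0 // ltW.
  have := @expR_ge1Dxn R _ 2 ux; rewrite /factorial /= => H; lra.
apply: le_trans (_ : (u * x / 2) ^+ 3 / 6 / (2 * x) / r%:R <= _); last first.
  rewrite ler_pM2r ?invr_gt0 //; apply: le_trans QH.
  by rewrite ler_pM2r // invr_gt0 mulr_gt0.
have -> : (u * x / 2) ^+ 3 / 6 / (2 * x) / r%:R =
    x * (x * u ^+ 3) / (96 * r%:R).
  by field; rewrite !gt_eqF.
rewrite ler_pdivlMr ?mulr_gt0 //.
have : 576 * r%:R <= x * u ^+ 3 by rewrite -ler_pdivrMr // exprn_gt0.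
move=> /(ler_wpM2l (ltW x0)); lra.
Qed.

(** The slack [eps >= 4 * u] is shared out: shrinking by [M = k %/ r] with
    [1 / r < u] costs a factor [1 - u], rounding costs another [u], and
    [(1 + 4 * u) * (1 - u) >= 1 + 2 * u] leaves the factor [1 + u] needed in
    [rectangle_decay_le]. *)
Lemma packing_parameters (eps : R) : 0 < eps ->
  exists Delta0 : nat, forall Delta : nat, (Delta0 <= Delta)%N ->
  exists k M r : nat,
    [/\ (0 < k)%N, (0 < Delta)%N, (0 < r)%N, (M + uphalf k <= k)%N &
        (k < 2 * (r * M))%N] /\
    [/\ k%:R ^+ 2 * rectangle_decay R k Delta M r <= 1,
        8 * k%:R ^+ 3 * rectangle_decay R k Delta M r * Delta%:R ^+ 2 <= 1 &
        k%:R <= (1 + eps) * (Delta%:R / ln Delta%:R)].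
Proof.
move=> eps0; pose u := Num.min eps 1 / 4.
have u0 : 0 < u by rewrite divr_gt0 // lt_min eps0 ltr01.
have u14 : u <= 1 / 4 by rewrite ler_pM2r ?invr_gt0 // ge_min lexx orbT.
have ueps : 4 * u <= eps.
  by rewrite /u mulrCA divff ?mulr1 ?pnatr_eq0 // ge_min lexx.
pose r := (Num.trunc u^-1).+1.
have r_gt : u^-1 < r%:R by apply: truncnS_gt.
have r4 : (4 <= r)%N.
  rewrite -(ler_nat R); apply/ltW; apply: le_lt_trans r_gt.
  by rewrite -[4]invrK lef_pV2 ?posrE //; lra.
pose X := 576 * r%:R / u ^+ 3.
exists (Num.trunc (expR X)).+1 => Delta leD.
have D_gt : expR X < Delta%:R.
  by apply: lt_le_trans (truncnS_gt _) _; rewrite ler_nat.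
have D0 : 0 < Delta%:R :> R by apply: lt_trans D_gt; apply: expR_gt0.
pose x : R := ln Delta%:R.
have Dx : Delta%:R = expR x by rewrite lnK.
have xX : X <= x by rewrite -ler_expR -Dx ltW.
have r1 : 4 <= r%:R :> R by rewrite ler_nat.
have u3 : u ^+ 3 * 1 <= u by nra.
have xr : 576 * r%:R <= x.
  apply: le_trans xX; rewrite /X ler_pdivlMr ?exprn_gt0 //.
  by nra.
have xu : 576 <= x * u.
  rewrite -ler_pdivrMr //; apply: le_trans xX; rewrite /X.
  rewrite ler_pdivlMr ?exprn_gt0 // mulrAC ler_pdivrMr //; nra.
have x0 : 0 < x by lra.
have Dxx : x / 2 <= Delta%:R / x.
  rewrite ler_pdivlMr // Dx.
  have := @expR_ge1Dxn R _ 1 (ltW x0); rewrite /factorial /= => H; lra.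
pose d := Delta%:R / x; rewrite -/d in Dxx.
have d0 : 0 < d by apply: divr_gt0.
have du : 288 <= d * u by nra.
pose z := (1 + 4 * u) * d.
have z0 : 0 <= z by rewrite mulr_ge0 //; lra.
pose k := Num.trunc z.
have kz : k%:R <= z by rewrite truncn_le.
have zk : z < k%:R + 1 by rewrite natr1 truncnS_gt.
pose M := (k %/ r)%N.
have rM : (M * r <= k)%N by apply: leq_divM.
have k2r : (2 * r <= k)%N.
  rewrite -(ler_nat R) natrM; rewrite /z in zk; have := mulr_gt0 u0 d0; lra.
have [Mwin kwin] := quotient_window r4 k2r.
have Mk : (M <= k)%N by apply: leq_div.
have kd : d <= k%:R by rewrite /z in zk; nra.
have mge : (1 + u) * d + 1 <= (k - M)%:R.
  have Mu : M%:R <= u * k%:R :> R.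
    have : (M * r)%:R <= k%:R :> R by rewrite ler_nat.
    rewrite natrM => Mr; have ru : 1 <= u * r%:R.
      by rewrite mulrC -ler_pdivrMr // mul1r ltW.
    have := ler0n R M; nra.
  rewrite natrB //; have : (1 - u) * (z - 1) <= (1 - u) * k%:R.
    by rewrite ler_wpM2l //; lra.
  rewrite /z; nra.
have u1 : u <= 1 by lra.
have r0 : (0 < r)%N by exact: leq_trans r4.
have decay := rectangle_decay_le u0 u1 x0 r0 Mk Dx mge kd xX.
have decay0 : 0 <= rectangle_decay R k Delta M r := expR_ge0 _.
have yD : rectangle_decay R k Delta M r * Delta%:R ^+ 6 <= 1.
  rewrite Dx -expRM_natl -ler_pdivlMr ?expR_gt0 // mul1r -expRN.
  exact: decay.
have D8 : 8 <= Delta%:R :> R.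
  by rewrite Dx; apply: le_trans (expR_ge1Dx _); lra.
have kD : k%:R <= Delta%:R :> R.
  have : d * x = Delta%:R by rewrite /d divfK ?gt_eqF.
  by rewrite /z in kz; nra.
move: decay0 yD; set y := rectangle_decay _ _ _ _ _ => decay0 yD.
exists k, M, r; split.
  split.
  - by rewrite (leq_trans _ k2r) // muln_gt0.
  - by rewrite -(ltr_nat R).
  - exact: r0.
  - exact: Mwin.
  - exact: kwin.
split.
- apply: le_trans yD; rewrite mulrC ler_wpM2l //.
  apply: le_trans (_ : Delta%:R ^+ 2 <= _); first by apply: lerXn2r; rewrite ?nnegrE.
  by apply: ler_weXn2l => //; lra.
- apply: le_trans yD; rewrite -/y.
  have -> : 8 * k%:R ^+ 3 * y * Delta%:R ^+ 2 = y * (8 * k%:R ^+ 3 * Delta%:R ^+ 2).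
    by ring.
  rewrite ler_wpM2l //.
  rewrite [leRHS](_ : _ = Delta%:R * Delta%:R ^+ 3 * Delta%:R ^+ 2); last by ring.
  rewrite ler_wpM2r ?exprn_ge0 // ler_pM ?exprn_ge0 //.
  by apply: lerXn2r; rewrite ?nnegrE.
- apply: le_trans kz _; rewrite /z; apply: ler_wpM2r; [exact: ltW | lra].
Qed.

End Asymptotics.

Theorem theorem7 (R : realType) (eps : R) (eps_gt0 : 0 < eps) :
  exists Delta0 : nat, forall Delta : nat, (Delta0 <= Delta)%N ->
  forall (V : finType) (e : rel V), symmetric e -> irreflexive e ->
  bipartite e -> (max_degree e <= Delta)%N ->
  exists chi : nat, is_list_packing_number e chi /\
    chi%:R <= (1 + eps) * (Delta%:R / ln (Delta%:R : R)).
Proof.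
have [Delta0 params] := packing_parameters eps_gt0.
exists Delta0 => Delta /params [k [M [r [[k0 D0 r0 Mk kM] [yk yD k_le]]]]].
move=> V e sym _ bip degD.
have packable : list_packable e k.
  by apply: (bipartite_list_packable (R := R)) yD _ _ _.
have packable_at_k : exists m, (0 < m)%N && `[< list_packable e m >].
  by exists k; rewrite k0; apply/asboolP.
case: (ex_minnP packable_at_k) => chi /andP [chi0 /asboolP chiP] chi_min.
exists chi; split.
  split=> // m m0 mP; apply: chi_min; rewrite m0; exact/asboolP.
apply: le_trans k_le; rewrite ler_nat; apply: chi_min.
by rewrite k0; apply/asboolP.
Qed.
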